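(* Let $F$ and $G$ be polyboxes in a $d$-box $X$. Then $F=G$ if and only if $\operatorname{ind}(F,C)=\operatorname{ind}(G,C)$ for every box $C$ of $X$ (proper or not).
   Context: A $d$-box is $X=X_1\times\cdots\times X_d$ with finite nonempty sets $X_i$. A box is a nonempty $A=A_1\times\cdots\times A_d$ with $A_i\subseteq X_i$; proper if $A_i\neq X_i$ for all $i$. Boxes $A,B$ are dichotomous if $A_i=X_i\setminus B_i$ for some $i$. A suit is a family of pairwise dichotomous boxes, proper if all its boxes are proper; a nonempty $F\subseteq X$ is a polybox if it is the union of some suit. For a box $C$ define $\varphi_C$ on proper boxes by $\varphi_C(A)=\prod_{i=1}^d\varphi_{C_i}(A_i)$, where $\varphi_{C_i}(A_i)=[A_i=C_i]-[A_i=X_i\setminus C_i]$ if $C_i\neq X_i$ and $\varphi_{C_i}\equiv1$ if $C_i=X_i$ (Iverson brackets). The index of a polybox $F$ relative to $C$ is $\operatorname{ind}(F,C)=\sum_{A\in\mathcal{G}}\varphi_C(A)$ for any proper suit $\mathcal{G}$ with $\bigcup\mathcal{G}=F$ (this value does not depend on the choice of $\mathcal{G}$).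
   Formalization: Every set X_i is assumed to have at least two elements, not merely to be nonempty; if some X_i is a singleton there are no proper boxes, so no polybox has a proper suit and its index is undefined. *)

(* Defs.v *)
From HB Require Import structures.
From mathcomp Require Import all_boot all_order all_algebra.
Set Implicit Arguments.
Unset Strict Implicit.
Unset Printing Implicit Defensive.
Import Order.TTheory GRing.Theory Num.Theory.
Local Open Scope ring_scope.

Definition point (d : nat) (X : 'I_d -> finType) := {dffun forall i, X i}.

(* A box is represented by the tuple of its sides A_i; since boxes are
   nonempty, the subset [setXn A] of X and the sides determine each other. *)
Definition sides (d : nat) (X : 'I_d -> finType) := {dffun forall i, {set X i}}.

Section Boxes.

Variables (d : nat) (X : 'I_d -> finType).

Implicit Types (A B C : sides X) (K : {set sides X}) (F : {set point X}).

Definition is_box A : bool := [forall i, A i != set0].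

Definition proper_box A : bool := is_box A && [forall i, A i != setT].

Definition dichotomous A B : bool := [exists i, A i == ~: B i].

Definition suit K : bool :=
  [forall A in K, is_box A]
  && [forall A in K, forall B in K, (A != B) ==> dichotomous A B].

Definition proper_suit K : bool := suit K && [forall A in K, proper_box A].

Definition suit_union K : {set point X} := \bigcup_(A in K) setXn A.

Definition polybox F : Prop :=
  F != set0 /\ exists K, suit K /\ suit_union K = F.

Definition side_phi (T : finType) (C A : {set T}) : int :=
  if C == setT then 1 else (A == C)%:R - (A == ~: C)%:R.

Definition phi C A : int := \prod_(i < d) side_phi (C i) (A i).

(* The sum does not depend on the chosen proper suit; the value 0 is a dummy
   for sets F that are not the union of a proper suit. *)
Definition ind F C : int :=
  if [pick K | proper_suit K && (suit_union K == F)] is Some K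
  then \sum_(A in K) phi C A else 0.

(* The index of a polybox can only be defined when all X_i have at least two
   elements: over a singleton X_i there is no proper box. *)
Lemma proper_box_card A : proper_box A -> forall i, (1 < #|X i|)%N.
Proof.
case/andP=> /forallP A0 /forallP AT i.
have := proper_card (A := mem (A i)) (B := mem [set: X i]).
rewrite properT (AT i) cardsT => /(_ isT); apply: leq_trans.
by rewrite ltnS card_gt0.
Qed.

End Boxes.

(* Main.v *)
Require Import Defs.
From mathcomp Require Import all_boot all_order all_algebra.
Set Implicit Arguments.
Unset Strict Implicit.
Unset Printing Implicit Defensive.
Import Order.TTheory GRing.Theory Num.Theory.
Local Open Scope ring_scope.

(** For a point [x] and a side [A] that is neither empty nor full, summing
    [side_phi C A] over all sides [C] containing [x] gives [2] if [x] lies in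
    [A] and [0] otherwise: the full side contributes [1], and exactly one of
    [C = A] and [C = ~: A] contains [x].  Taking products over the coordinates
    and summing over a proper suit of [F] yields
    [\sum_(C | x \in C) ind F C = 2 ^+ d * [x \in F]],
    so the indices determine [F].  A polybox is the union of a proper suit
    because full sides can be split as [S i] and [~: S i], with the same
    arbitrary [S i] for every box of the suit. *)

(** Distributivity where the range of summation varies with the factor. It turns a product over
    coordinates of sums over sides into a single sum over tuples of sides. *)
Lemma bigA_distr_dffun (R : comPzSemiRingType) (I : finType) (T : I -> finType)
    (P : forall i, T i -> R) :
  \prod_i \sum_j P i j = \sum_(f : {dffun forall i, T i}) \prod_i P i (f i).
Proof.
rewrite (reindex (@dffun_of_fprod I T)); last first.
  exact/onW_bij/dffun_of_fprod_bij.
pose Q i := [ffun j : T i => P i j].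
under [RHS]eq_bigr do
  under eq_bigr => i _ do rewrite ffunE -[P _ _](ffunE (P i)) -/(Q i).
rewrite (big_fprod 1 _ Q).
rewrite -(bigA_distr_big_dep (tagged_with T) (fun i => untag 0 (Q i))).
apply: eq_bigr => i _; rewrite -(big_tag Q); by apply: eq_bigr => j _; rewrite ffunE.
Qed.

Lemma sum_side_phi (T : finType) (A : {set T}) (x : T) :
  A != set0 -> A != setT ->
  \sum_(C : {set T} | x \in C) side_phi C A = 2 * (x \in A)%:R.
Proof.
move=> A0 AT; rewrite (bigD1 [set: T]) ?inE //= {1}/side_phi eqxx.
have AC : (A == ~: A) = false.
  by apply/eqP=> /setP/(_ x); rewrite inE; case: (x \in A).
have xB : x \in if x \in A then A else ~: A by case: ifPn; rewrite ?inE.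
have BT : (if x \in A then A else ~: A) != setT.
  by case: ifP => // _; rewrite -setC0 (inj_eq (can_inj (@setCK _))).
(* This term is [1] if [x] lies in [A] and [-1] otherwise; [AC] ensures that its two brackets do not
   cancel. *)
rewrite (bigD1 (if x \in A then A else ~: A)) /=; last by rewrite xB.
rewrite big1 => [|C /andP[/andP[xC CT] CB]].
  rewrite /side_phi (negPf BT).
  by case: ifP => _; rewrite ?setCK ?eqxx AC.
rewrite /side_phi (negPf CT).
have -> : (A == ~: C) = (C == ~: A).
  by apply/eqP/eqP => ->; rewrite setCK.
case: ifP CB => xA /negPf CB; rewrite eq_sym ?CB ?sub0r ?subr0.
  by case: eqP xC => // ->; rewrite inE xA.
by case: eqP xC => // ->; rewrite xA.
Qed.

Section PolyboxIndex.

Variables (d : nat) (X : 'I_d -> finType).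

Implicit Types (A B C S : sides X) (K : {set sides X}) (F : {set point X}).

Lemma sum_phi A (x : point X) : proper_box A ->
  \sum_(C : sides X | x \in setXn C) phi C A = 2 ^+ d * (x \in setXn A)%:R.
Proof.
case/andP=> /forallP A0 /forallP AT.
transitivity (\prod_(i < d) \sum_(C : {set X i} | x i \in C) side_phi C (A i)).
  under [RHS]eq_bigr do rewrite big_mkcond.
  rewrite (bigA_distr_dffun
    (fun i (C : {set X i}) => if x i \in C then side_phi C (A i) else 0)).
  rewrite big_mkcond; apply: eq_bigr => C _.
  (* A tuple [C] missing [x] at some coordinate has a zero factor there, so only the tuples with
     [x \in setXn C] survive. *)
  case: ifPn => [/setXnP xC | ].
    by apply: eq_bigr => i _; rewrite xC.
  rewrite in_setXn negb_forall => /existsP[i /negPf xC].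
  by rewrite (bigD1 i) //= xC mul0r.
under eq_bigr do rewrite sum_side_phi //.
rewrite big_split prodr_const card_ord; congr (_ * _).
case: (boolP (x \in setXn A)) => [/setXnP xA | ].
  by apply: big1 => i _; rewrite xA.
rewrite in_setXn negb_forall => /existsP[i /negPf xA].
by rewrite (bigD1 i) //= xA mul0r.
Qed.

Lemma dichotomous_disjoint A B :
  dichotomous A B -> [disjoint setXn A & setXn B].
Proof.
case/existsP=> i /eqP ABi; apply/pred0P=> x /=.
apply/negP=> /andP[/setXnP/(_ i) xA /setXnP/(_ i) xB].
by move: xA; rewrite ABi inE xB.
Qed.

(** Dichotomous boxes are disjoint, so at most one box of the suit contains [x]. *)
Lemma suit_union_indicator K (x : point X) : suit K ->
  \sum_(A in K) (x \in setXn A)%:R = (x \in suit_union K)%:R :> int.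
Proof.
case/andP=> _ /forall_inP Kdich.
case: (boolP (x \in suit_union K)) => [/bigcupP[A AK xA] | xK]; last first.
  apply: big1 => A AK; case: (boolP (x \in setXn A)) => // xA.
  by case/bigcupP: xK; exists A.
rewrite (bigD1 A) //= xA big1 ?addr0 // => B /andP[BK BA].
have /implyP/(_ BA)/dichotomous_disjoint/disjointFl -> // :=
  forall_inP (Kdich B BK) A AK.
Qed.

Lemma exists_proper_box (hX : forall i, (1 < #|X i|)%N) :
  exists S, proper_box S.
Proof.
have x0 i : {x : X i | true}.
  case: (pickP (mem (X i))) => [x _ | X0]; first by exists x.
  by have := hX i; rewrite (eq_card0 X0).
exists [ffun i => [set sval (x0 i)]].
apply/andP; split; apply/forallP=> i; rewrite ffunE.
  by rewrite -card_gt0 cards1.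
by apply/eqP=> /(congr1 (fun D : {set _} => #|D|)); rewrite cards1 cardsT => Xi;
  have := hX i; rewrite -Xi.
Qed.

(** For proper [S], the boxes [B] refining [A] are the cells of a partition of [A] into proper
    boxes, provided [A] is a box. *)
Definition refines S A B : bool :=
  [forall i, if A i == setT then (B i == S i) || (B i == ~: S i)
             else B i == A i].

Lemma suit_refinement K : (forall i, (1 < #|X i|)%N) -> suit K ->
  exists2 K', proper_suit K' & suit_union K' = suit_union K.
Proof.
case/exists_proper_box=> S /andP[/forallP S0 /forallP ST].
case/andP=> /forall_inP Kbox /forall_inP Kdich.
have setC_eq0 i (D : {set X i}) : (~: D == set0) = (D == setT).
  by rewrite -setCT (inj_eq (can_inj (@setCK _))).
have setC_eqT i (D : {set X i}) : (~: D == setT) = (D == set0).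
  by rewrite -setC0 (inj_eq (can_inj (@setCK _))).
pose K' := [set B | [exists A in K, refines S A B]].
have K'P B : reflect (exists2 A, A \in K & refines S A B) (B \in K').
  by rewrite inE; apply: exists_inP.
have K'proper B : B \in K' -> proper_box B.
  case/K'P=> A /Kbox/forallP A0 /forallP AB.
  apply/andP; split; apply/forallP=> i; move: (AB i).
    by case: ifP => _ => [/orP[]|] /eqP ->; rewrite ?setC_eq0.
  by case: ifPn => AT => [/orP[]|] /eqP ->; rewrite ?setC_eqT.
exists K'.
  apply/andP; split; last exact/forall_inP.
  apply/andP; split.
    by apply/forall_inP=> B /K'proper/andP[].
  apply/forall_inP=> B BK'; apply/forall_inP=> B' BK''; apply/implyP=> BB'.
  case/K'P: BK' => A AK /forallP AB; case/K'P: BK'' => A' AK' /forallP AB'.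
  apply/existsP; have [eA | AA'] := eqVneq A A'.
    (* Two distinct cells of the same box differ only at coordinates that were split, and there they
       are complementary. *)
    have [i Bi] : exists i, B i != B' i.
      apply/existsP; rewrite -negb_forall; apply: contra BB' => /forallP eB.
      by apply/eqP/ffunP=> i; apply/eqP.
    exists i; move: (AB i) (AB' i) Bi; rewrite -eA.
    case: ifP => _; last by move=> /eqP -> /eqP ->; rewrite eqxx.
    by move=> /orP[] /eqP -> /orP[] /eqP ->; rewrite ?setCK ?eqxx.
  (* Cells of different boxes inherit the dichotomy: at coordinate [i] neither side is full, since
     its complement is nonempty, so neither was split. *)
  have /implyP/(_ AA')/existsP[i /eqP Ai] := forall_inP (Kdich A AK) A' AK'.
  have /forallP/(_ i) := Kbox _ AK; have /forallP/(_ i) := Kbox _ AK'.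
  move=> A'0 A0; exists i; move: (AB i) (AB' i).
  have -> : (A i == setT) = false by rewrite Ai setC_eqT (negPf A'0).
  have -> : (A' i == setT) = false by rewrite -setC_eq0 -Ai (negPf A0).
  by move=> /eqP -> /eqP ->; rewrite Ai.
apply/setP=> x; apply/bigcupP/bigcupP.
  case=> B /K'P[A AK /forallP AB] /setXnP xB; exists A => //.
  apply/setXnP=> i; move: (AB i) (xB i).
  by case: eqP => [-> | _ /eqP ->] //; rewrite inE.
case=> A AK /setXnP xA.
(* The cell of [A] containing [x]: at each full side, take the half in which [x i] lies. *)
exists [ffun i => if A i == setT
                  then (if x i \in S i then S i else ~: S i) else A i].
  apply/K'P; exists A => //; apply/forallP=> i; rewrite ffunE.
  by case: (A i == setT) => //; case: (x i \in S i); rewrite eqxx ?orbT.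
apply/setXnP=> i; rewrite ffunE.
by case: ifP => // _; case: ifPn => //; rewrite inE.
Qed.

Lemma sum_ind F (x : point X) : (forall i, (1 < #|X i|)%N) -> polybox F ->
  \sum_(C : sides X | is_box C && (x \in setXn C)) ind F C
    = 2 ^+ d * (x \in F)%:R.
Proof.
move=> hX [_ [K0 [/(suit_refinement hX)[K Kp KK0] K0F]]].
(* The refined suit [K] rules out the dummy value [0]; whichever proper suit [K'] is picked, the
   computation below applies to it. *)
rewrite /ind; case: pickP => [{KK0 K0F K0}K' | /(_ K)]; last first.
  by rewrite Kp KK0 K0F eqxx.
case/andP=> {K Kp}/andP[Ks /forall_inP Kp] /eqP <-.
rewrite -(suit_union_indicator x Ks) mulr_sumr exchange_big /=.
apply: eq_bigr => A /Kp Ap; rewrite -sum_phi //.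
(* Containing [x] already forces every side of [C] to be nonempty. *)
apply: eq_bigl => C; case: setXnP => [xC|]; rewrite ?andbF // andbT.
by apply/forallP=> i; apply/set0Pn; exists (x i).
Qed.

End PolyboxIndex.

Local Close Scope ring_scope.

Theorem theorem6p4 (d : nat) (X : 'I_d -> finType)
    (hX : forall i, 1 < #|X i|)
    (F G : {set point X}) (hF : polybox F) (hG : polybox G) :
  F = G <-> (forall C : sides X, is_box C -> ind F C = ind G C).
Proof.
split=> [-> // | eqFG]; apply/setP=> x.
have := sum_ind x hX hG.
under eq_bigr => C /andP[boxC _] do rewrite -eqFG //.
(* Cancelling [2 ^+ d], nonzero in the integers, leaves equal indicators at [x]. *)
rewrite (sum_ind x hX hF) => /(mulfI (expf_neq0 d _))-/(_ isT).
by case: (x \in F) (x \in G) => [] [].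
Qed.
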